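(* Let $X$ be a set, let $B(X)$ be the space of all bounded real-valued functions on $X$, and let $\{f_n : n\in\mathbb{N}\}\subseteq B(X)$ be a uniformly bounded sequence. The following are equivalent: (i) there is a positive linear functional $T$ on $B(X)$, an infinite set $I\subseteq\mathbb{N}$ with $\bar{d}(I)>0$, and an $r>0$ such that $|T(f_n)|>r$ for every $n\in I$; (ii) there exists a sequence $\{x_k : k\in\mathbb{N}\}$ in $X$, a set $I\subseteq\mathbb{N}$ with $\bar{d}(I)>0$, and an $r>0$ such that $\liminf_{k\to\infty}|f_n(x_k)|>r$ for every $n\in I$.
   Context: For $I\subseteq\mathbb{N}$, the upper asymptotic density of $I$ is $\bar{d}(I)=\limsup_{n\to\infty}\frac{|I\cap\{1,2,\dots,n\}|}{n}$, where $|\cdot|$ of a finite set denotes its cardinality. A linear functional $T:B(X)\to\mathbb{R}$ is positive if $T(g)\ge 0$ whenever $g\in B(X)$ and $g\ge 0$ pointwise. Uniformly bounded means there is $M>0$ with $|f_n(x)|\le M$ for all $n\in\mathbb{N}$ and $x\in X$. *)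

(* Defs.v *)
From HB Require Import structures.
From mathcomp Require Import all_boot all_order all_algebra finmap.
From mathcomp Require Import all_classical all_reals all_analysis.
Import Order.TTheory GRing.Theory Num.Theory numFieldNormedType.Exports.

Set Implicit Arguments.
Unset Strict Implicit.
Unset Printing Implicit Defensive.

Local Open Scope classical_set_scope.
Local Open Scope ring_scope.

Section BoundedFunctions.
Variables (X : Type) (R : realType).

Definition bounded_pred : {pred X -> R^o} := mem (bounded_fun : set (X -> R^o)).

Lemma bounded_predP (g : X -> R^o) :
  reflect (exists M : R, forall x, `|g x| <= M) (g \in bounded_pred).
Proof.
apply: (iffP idP); rewrite inE /= /bounded_near.
  by case/pinfty_ex_gt0=> M _ /= gM; exists M => x; exact: gM.
case=> M gM; near=> N; move=> x _ /=.
by apply: le_trans (gM x) _; near: N; exact: nbhs_pinfty_ge (num_real M).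
Unshelve. all: by end_near. Qed.

Lemma bounded_submod_closed : submod_closed bounded_pred.
Proof.
split; first by apply/bounded_predP; exists 0 => x; rewrite normr0.
move=> a g h /bounded_predP[M gM] /bounded_predP[N hN].
apply/bounded_predP; exists (`|a| * M + N) => x.
apply: le_trans (ler_normD _ _) _; apply: lerD (hN x).
by rewrite normrM ler_wpM2l.
Qed.

HB.instance Definition _ :=
  GRing.isSubmodClosed.Build R (X -> R^o) bounded_pred bounded_submod_closed.

(* B(X). The codomain is R^o (R as a module over itself) so that X -> R^o, and
   hence this subtype, carries the pointwise R-module structure. *)
Record bfun := BFun { bfun_val :> X -> R^o; _ : bfun_val \in bounded_pred }.

HB.instance Definition _ := [isSub for bfun_val].
HB.instance Definition _ := [Choice of bfun by <:].
HB.instance Definition _ := [SubChoice_isSubLmodule of bfun by <:].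

Definition positive_functional (T : bfun -> R) :=
  forall g : bfun, (forall x, 0 <= g x) -> 0 <= T g.

Definition uniformly_bounded (f : nat -> bfun) :=
  exists2 M : R, 0 < M & forall n x, `|f n x| <= M.

End BoundedFunctions.

(* The term n = 0 is 0 / 0 = 0 and does not affect the limsup; all terms lie in
   [0, 1], so the real-valued limsup is the genuine one. *)
Definition upper_density (R : realType) (I : set nat) : R :=
  limn_sup (fun n : nat =>
    #|` fset_set (I `&` [set k | (1 <= k <= n)%N]) |%:R / n%:R : R).

(* Main.v *)
Require Import Defs.
From HB Require Import structures.
From mathcomp Require Import all_boot all_order all_algebra finmap.
From mathcomp Require Import all_classical all_reals all_analysis.
From mathcomp Require Import ring lra.
Import Order.TTheory GRing.Theory Num.Theory numFieldNormedType.Exports.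

Set Implicit Arguments.
Unset Strict Implicit.
Unset Printing Implicit Defensive.

Local Open Scope classical_set_scope.
Local Open Scope ring_scope.

(**
Only the passage from a functional to points needs work; the converse takes
T g to be the limit of g (x k) along a free ultrafilter on the integers.

Let T be positive with |T (f n)| > r on a set of positive upper density, and
put g n = |f n|, so that T (g n) > r on the same set. There are d > 0 and
integers N_j >= j such that the Cesaro averages h_j = (g 1 + ... + g N_j) / N_j
satisfy T h_j >= d. If T were integration against a measure, Fatou's lemma
would give a point x at which h_j x stays above some c > 0 for infinitely many
j, and {n | g n x > c / 2} would have positive upper density. A finitely
additive T need not charge any point of X and may only be represented on a
compactification, whose points are approached from X; this is why a sequence
appears on the other side of the equivalence.

The finitely additive substitute for Fatou is [positive_functional_fatou].
Choose blocks [m, m + l m] such that the maximum C_m of h over the block almost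
attains the supremum of T over the maxima of all blocks starting at m. Adding
another h_K with K >= m to the maximum then hardly increases its T-value, hence
T (h_K - C_m)^+ is tiny. Summing over m <= K, the bound T h_K >= d forces a point
y_K at which all of C_0, ..., C_K are at least c. Along a free ultrafilter
g n (y_K) tends to some phi n, and, each block being finite, it contains some j
for which the average of phi over {1, ..., N_j} is at least c. So phi > c / 2 on
a set of positive upper density ([upper_density_superlevel]), and a diagonal
subsequence of (y_K) realizes phi as an ordinary limit
([cesaro_representing_points]).
*)

(** * Upper limits, Cesaro averages and upper density *)

Section RealSequences.
Variable R : realType.
Implicit Types (u a : nat -> R) (I : set nat) (b c d r : R) (N m n : nat).

Lemma frequently_lt_limn_sup u d :
  bounded_fun (u : nat -> R^o) -> d < limn_sup u ->
  forall m, exists2 N, (m <= N)%N & d < u N.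
Proof.
move=> bu; rewrite limn_supE// => du m.
have: d < sup (sdrop u m).
  apply: (lt_le_trans du); apply: ge_inf; last by exists m.
  exact: bounded_fun_has_lbound_sups.
case/sup_gt => [|_ [N /= mN <-] dN]; first by exists (u m), m => /=.
by exists N.
Qed.

Lemma frequently_ge_le_limn_sup u d :
  bounded_fun (u : nat -> R^o) ->
  (forall m, exists2 N, (m <= N)%N & d <= u N) -> d <= limn_sup u.
Proof.
move=> bu du; rewrite limn_supE//; apply: lb_le_inf.
  by exists (sups u 0), 0%N.
move=> _ [m _ <-]; have [N mN dN] := du m; apply: (le_trans dN).
apply: ub_le_sup; last by exists N.
exact/has_ubound_sdrop/bounded_fun_has_ubound.
Qed.

Lemma near_gt_limn_inf u r :
  bounded_fun (u : nat -> R^o) -> r < limn_inf u -> \forall k \near \oo, r < u k.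
Proof.
move=> bu; rewrite limn_infE//.
case/sup_gt => [|_ [n _ <-] rn]; first by exists (infs u 0), 0%N.
exists n => // k /= nk; apply: (lt_le_trans rn); apply: ge_inf; last by exists k.
exact/has_lbound_sdrop/bounded_fun_has_lbound.
Qed.

(** Starts at 1 because the density counts members of {1, ..., N}; the value at
    N = 0 is 0, from division by zero. *)
Definition cesaro a N : R := (\sum_(1 <= k < N.+1) a k) / N%:R.

Lemma ler_cesaro a a' N : (forall k, a k <= a' k) -> cesaro a N <= cesaro a' N.
Proof.
by move=> aa'; rewrite /cesaro ler_wpM2r ?invr_ge0// ler_sum.
Qed.

Lemma cesaroD a a' N :
  cesaro (fun k => a k + a' k) N = cesaro a N + cesaro a' N.
Proof. by rewrite /cesaro big_split mulrDl. Qed.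

Lemma cesaroZ c a N : cesaro (fun k => c * a k) N = c * cesaro a N.
Proof. by rewrite /cesaro -mulr_sumr mulrA. Qed.

Lemma cesaro_cst_le c N : 0 <= c -> cesaro (fun=> c) N <= c.
Proof.
move=> c0; case: N => [|N]; first by rewrite /cesaro big_geq// mul0r.
rewrite /cesaro big_const_nat iter_addr_0 subn1/= -[c *+ _]mulr_natr.
by rewrite mulfK// pnatr_eq0.
Qed.

Lemma cesaro_bounded a b : 0 <= b -> (forall k, 0 <= a k <= b) ->
  forall N, 0 <= cesaro a N <= b.
Proof.
move=> b0 ab N; apply/andP; split.
  by rewrite mulr_ge0 ?invr_ge0// sumr_ge0// => k _; case/andP: (ab k).
apply: (@le_trans _ _ (cesaro (fun=> b) N)); last exact: cesaro_cst_le.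
by apply: ler_cesaro => k; case/andP: (ab k).
Qed.

Lemma card_fset_set_initial I n :
  #|` fset_set (I `&` [set k | (1 <= k <= n)%N]) |%:R =
  \sum_(1 <= k < n.+1) (k \in I)%:R :> R.
Proof.
have -> : fset_set (I `&` [set k | (1 <= k <= n)%N]) =
  [fset k in [seq k <- index_iota 1 n.+1 | k \in I]]%fset.
  apply/fsetP => k; rewrite in_fset_set; last first.
    by apply: finite_setIr; apply: (sub_finite_set (B := `I_n.+1)) => //= i /andP[_].
  rewrite !inE/= mem_filter mem_index_iota ltnS.
  apply/idP/idP; rewrite inE/=; first by case=> Ik kn; apply/andP; split => //; rewrite inE.
  by case/andP => /set_mem Ik kn; split.
rewrite card_fseq undup_id ?filter_uniq ?iota_uniq// size_filter -sum1_count.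
by rewrite natr_sum big_mkcond; apply: eq_bigr => k _; case: (k \in I).
Qed.

Lemma upper_densityE I : upper_density R I = limn_sup (cesaro (fun k => (k \in I)%:R)).
Proof.
rewrite /upper_density /cesaro; congr limn_sup.
by apply/funext => n; rewrite card_fset_set_initial.
Qed.

Lemma cesaro_indic_bounded I :
  bounded_fun (cesaro (fun k => (k \in I)%:R) : nat -> R^o).
Proof.
exists 1; split; first exact: num_real.
move=> M M1 N _ /=.
have /andP[h0 h1] : 0 <= cesaro (fun k => (k \in I)%:R) N <= 1.
  by apply: cesaro_bounded => // k; case: (k \in I); rewrite /= ?lexx ?ler01.
by rewrite ger0_norm//; apply: le_trans h1 (ltW M1).
Qed.

Lemma upper_density_gt0 I : 0 < upper_density R I ->
  exists2 d, 0 < d &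
    forall m, exists2 N, (m <= N)%N & d < cesaro (fun k => (k \in I)%:R) N.
Proof.
rewrite upper_densityE => I0; exists (limn_sup (cesaro (fun k => (k \in I)%:R)) / 2).
  by rewrite divr_gt0.
apply: frequently_lt_limn_sup; first exact: cesaro_indic_bounded.
by rewrite gtr_pMr// invf_lt1// ltr1n.
Qed.

(** The averages of the indicator of a finite I are at most #|I| / N, which tends
    to 0. *)
Lemma upper_density_gt0_infinite I : 0 < upper_density R I -> infinite_set I.
Proof.
case/upper_density_gt0 => d d0 Id finI; set c := #|` fset_set I|%:R : R.
have [N cN] := Id (Num.truncn (c / d)).+1; rewrite /cesaro -card_fset_set_initial.
have N0 : 0 < N%:R :> R by rewrite ltr0n (leq_trans _ cN).
rewrite ltr_pdivlMr//; apply/negP; rewrite -leNgt.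
apply: (@le_trans _ _ c).
  rewrite ler_nat fsubset_leq_card// -fset_set_sub//; exact: finite_setIl.
rewrite mulrC -ler_pdivrMr// (le_trans (ltW (truncnS_gt _)))// ler_nat//.
Qed.

(** Markov's inequality for the averaging measures on {1, ..., N}: since
    a <= c / 2 + b 1_J pointwise, a large average forces J to have proportion at
    least c / (2 b). *)
Lemma upper_density_superlevel a b c : 0 < c -> (forall k, 0 <= a k <= b) ->
  (forall m, exists2 N, (m <= N)%N & c <= cesaro a N) ->
  0 < upper_density R [set k | c / 2 < a k].
Proof.
move=> c0 ab ac; set J := [set k | _].
have b0 : 0 < b.
  rewrite lt_neqAle; apply/andP; split; last by case/andP: (ab 0%N); apply: le_trans.
  apply/eqP => b0; have [N _] := ac 0%N; apply/negP; rewrite -ltNge.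
  have /andP[_ aN0] : 0 <= cesaro a N <= 0.
    by apply: cesaro_bounded => // k; have := ab k; rewrite -b0.
  exact: le_lt_trans aN0 c0.
apply: (@lt_le_trans _ _ (c / 2 / b)); first by rewrite !divr_gt0.
rewrite upper_densityE; apply: frequently_ge_le_limn_sup.
  exact: cesaro_indic_bounded.
move=> m; have [N mN cN] := ac m; exists N => //.
rewrite ler_pdivrMr//.
have : cesaro a N <= c / 2 + cesaro (fun k => (k \in J)%:R) N * b.
  rewrite [X in _ + X]mulrC -cesaroZ.
  apply: (@le_trans _ _ (cesaro (fun k => c / 2 + b * (k \in J)%:R) N)).
    apply: ler_cesaro => k; have /andP[_ kb] := ab k.
    have [|] := boolP (k \in J); rewrite ?(mulr1,mulr0,addr0).
      by move=> _; rewrite (le_trans kb)// lerDr divr_ge0// ltW.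
    by rewrite notin_setE /J/= => /negP; rewrite -leNgt.
  by rewrite cesaroD lerD2r cesaro_cst_le// divr_ge0// ltW.
by move: cN; lra.
Qed.

End RealSequences.

(** * Limits along a free ultrafilter *)

Section Ultralimits.
Variable R : realType.

(** All bounded sequences converge simultaneously: a compact interval makes the
    image ultrafilter cluster somewhere, and an ultrafilter converges to its
    cluster points. Containing the cofinite filter makes these limits extend
    the usual ones. *)
Lemma free_ultralimit : exists U : set_system nat,
  [/\ ProperFilter U, \oo `<=` U &
      forall (u : nat -> R) (M : R), (forall k, `|u k| <= M) -> cvg (u @ U)].
Proof.
have [U [ultraU ooU]] := @ultraFilterLemma nat \oo _.
have propU : ProperFilter U by exact: ultra_proper.
exists U; split => // u M uM.
have [|p [_ up]] := @segment_compact R (- M) M (u @ U) _.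
  by apply: (@filterE _ U _ (u @^-1` `[- M, M])) => k; rewrite /= in_itv/= -ler_norml.
apply/cvg_ex; exists p => V Vp.
have [//|nV] := in_ultra_setVsetC (u @^-1` V) ultraU.
by have [x [nVx Vx]] := up (~` V) V nV Vp; case: (nVx Vx).
Qed.

(** Countably many limits along any filter can be realized along one sequence:
    the condition imposed at stage k, that g 0, ..., g k be within 1 / (k + 1) of
    their limits, is a finite conjunction of events of the filter. *)
Lemma diagonal_subsequence (U : set_system nat) (g : nat -> nat -> R) (phi : nat -> R) :
  ProperFilter U -> (forall n, g n @ U --> phi n) ->
  exists s : nat -> nat, forall n, (g n \o s : nat -> R) @ \oo --> phi n.
Proof.
move=> FU gphi.
have near_k k : \forall K \near U, forall i : 'I_k.+1, `|phi i - g i K| < k.+1%:R^-1.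
  apply: filter_forall => i.
  by have /cvgrPdist_lt/(_ k.+1%:R^-1) := gphi i; apply; rewrite invr_gt0.
have {near_k} near_ex k : exists K, forall i : 'I_k.+1, `|phi i - g i K| < k.+1%:R^-1.
  exact: filter_ex (near_k k).
have [s sP] := choice near_ex.
exists s => n; apply/cvgrPdist_lt => e e0.
near=> k.
have nk : (n < k.+1)%N by rewrite ltnS; near: k; exact: nbhs_infty_ge.
apply: (lt_trans (sP k (Ordinal nk))).
near: k; exact: (@near_infty_natSinv_lt R (PosNum e0)).
Unshelve. all: by end_near. Qed.

Lemma cvg_cesaro (U : set_system nat) (g : nat -> nat -> R) (phi : nat -> R) N :
  Filter U -> (forall n, g n @ U --> phi n) ->
  cesaro (fun n => g n k) N @[k --> U] --> cesaro phi N.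
Proof.
move=> FU gphi; rewrite /cesaro; apply: cvgMr_tmp.
elim: (index_iota _ _) => [|n s IH].
  rewrite big_nil; under eq_fun do rewrite big_nil; exact: cvg_cst.
rewrite big_cons; under eq_fun do rewrite big_cons.
exact: (cvgD (gphi n) IH).
Qed.

End Ultralimits.

(** * Positive functionals on bounded functions *)

Section PositiveFunctionals.
Variables (X : Type) (R : realType).
Implicit Types g h : bfun X R.

Lemma bfun_bounded g : exists M : R, forall x, `|g x| <= M.
Proof. by apply/bounded_predP; case: g. Qed.

Lemma bounded_cst (c : R) : (fun=> c) \in @bounded_pred X R.
Proof. by apply/bounded_predP; exists `|c|. Qed.
Definition bfun_cst (c : R) : bfun X R := BFun (bounded_cst c).

Lemma bounded_max g h : (fun x => Num.max (g x) (h x)) \in @bounded_pred X R.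
Proof.
have [[M gM] [N hN]] := (bfun_bounded g, bfun_bounded h).
apply/bounded_predP; exists (Num.max M N) => x.
by case: (leP (g x) (h x)) => _; rewrite le_max ?gM ?hN ?orbT.
Qed.
Definition bfun_max g h : bfun X R := BFun (bounded_max g h).

Lemma bounded_norm g : (fun x => `|g x|) \in @bounded_pred X R.
Proof.
have [M gM] := bfun_bounded g.
by apply/bounded_predP; exists M => x; rewrite normr_id.
Qed.
Definition bfun_norm g : bfun X R := BFun (bounded_norm g).

Lemma bfunD g h x : (g + h) x = g x + h x. Proof. by []. Qed.
Lemma bfunN g x : (- g) x = - g x. Proof. by []. Qed.
Lemma bfunZ (c : R) g x : (c *: g) x = c * g x. Proof. by []. Qed.
Lemma bfun_sum (J : Type) (s : seq J) (F : J -> bfun X R) x :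
  (\sum_(j <- s) F j) x = \sum_(j <- s) F j x.
Proof.
by elim: s => [|j s IH]; rewrite ?big_nil// !big_cons bfunD IH.
Qed.

Variables (T : {scalar bfun X R}) (T_ge0 : positive_functional T).

Lemma positive_functional_le g h : (forall x, g x <= h x) -> T g <= T h.
Proof.
move=> gh; rewrite -subr_ge0 -linearB; apply: T_ge0 => x.
by rewrite bfunD bfunN subr_ge0.
Qed.

Lemma positive_functional_cst c : T (bfun_cst c) = c * T (bfun_cst 1).
Proof.
rewrite -[RHS]/(c *: T _) -linearZ; congr (T _); apply/val_inj/funext => x.
by rewrite -[RHS]/(c * 1) mulr1.
Qed.

Lemma positive_functional_norm g : `|T g| <= T (bfun_norm g).
Proof.
rewrite ler_norml lerNl -linearN; apply/andP; split;
  apply: positive_functional_le => x; rewrite ?bfunN/= ?ler_norm//.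
by rewrite -normrN ler_norm.
Qed.

(** A block is given by its first index m and the number p of further indices,
    so that the maximum is never over the empty set. *)
Fixpoint bfun_maxn (h : nat -> bfun X R) m p :=
  if p is p'.+1 then bfun_max (bfun_maxn h m p') (h (m + p)%N) else h m.

Lemma bfun_maxn_ge (h : nat -> bfun X R) m p j x :
  (m <= j <= m + p)%N -> h j x <= bfun_maxn h m p x.
Proof.
elim: p => [|p IH] /=; first by rewrite addn0 -eqn_leq => /eqP ->.
case/andP => mj; rewrite addnS leq_eqVlt => /orP[/eqP ->|jp].
  by rewrite le_max lexx orbT.
by rewrite le_max IH// mj.
Qed.

Lemma bfun_maxn_attained (h : nat -> bfun X R) m p x :
  exists2 j, (m <= j <= m + p)%N & bfun_maxn h m p x = h j x.
Proof.
elim: p => [|p [j /andP[mj jp] IH]] /=; first by exists m; rewrite ?leqnn ?leq_addr.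
case: (leP (bfun_maxn h m p x) (h (m + p.+1)%N x)) => _.
  by exists (m + p.+1)%N; rewrite ?leqnn ?leq_addr.
by exists j; rewrite // mj addnS ltnW.
Qed.

(** The choice of a block: extending it to the right gains at most e. *)
Lemma positive_functional_near_sup (h : nat -> bfun X R) (M e : R) m :
  (forall j x, h j x <= M) -> 0 < e ->
  exists l, forall p, T (bfun_maxn h m p) <= T (bfun_maxn h m l) + e.
Proof.
move=> hM e0; pose E := range (fun p => T (bfun_maxn h m p)).
have ubE : has_ubound E.
  exists (T (bfun_cst M)) => _ [p _ <-]; apply: positive_functional_le => x.
  by have [j _ ->] := bfun_maxn_attained h m p x; exact: hM.
have supE : has_sup E by split => //; exists (T (bfun_maxn h m 0)), 0%N.
have [_ [l _ <-] lE] := sup_adherent e0 supE.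
exists l => p; have pE : T (bfun_maxn h m p) <= sup E by apply: ub_le_sup => //; exists p.
by rewrite (le_trans pE)// -lerBlDr ltW.
Qed.

Lemma sum_dyadic_le (eta : R) n : 0 <= eta -> \sum_(m < n) eta / 2 ^+ m.+1 <= eta.
Proof.
move=> eta0; suff -> : \sum_(m < n) eta / 2 ^+ m.+1 = eta - eta / 2 ^+ n.
  by rewrite gerBl divr_ge0// exprn_ge0.
elim: n => [|n IH]; first by rewrite big_ord0 expr0 divr1 subrr.
rewrite big_ord_recr/= IH exprS; field.
by rewrite expf_neq0// pnatr_eq0.
Qed.

(** A Fatou lemma without countable additivity. The function l does not depend
    on K; this uniformity lets one pass to a limit of the points x as K grows
    while keeping, for each m, only finitely many candidates j. *)
Lemma positive_functional_fatou (h : nat -> bfun X R) (M eta : R) :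
  0 < eta -> (forall j x, h j x <= M) -> (forall j, eta <= T (h j)) ->
  exists2 c : R, 0 < c & exists l : nat -> nat, forall K, exists x,
    forall m, (m <= K)%N -> exists2 j, (m <= j <= m + l m)%N & c <= h j x.
Proof.
move=> eta0 hM hT.
(* Errors summing to at most eta / 2 over all blocks. *)
pose eps m : R := eta / 2 / 2 ^+ m.+1.
have eps0 m : 0 < eps m by rewrite !divr_gt0// exprn_gt0.
have [l lP] := choice (fun m => positive_functional_near_sup m hM (eps0 m)).
set T1 := T (bfun_cst 1).
have T1_ge0 : 0 <= T1 by apply: T_ge0 => x /=.
(* T 1 may vanish a priori, whence the + 1. *)
pose c := eta / 4 / (T1 + 1).
have cT1 : c * T1 <= eta / 4.
  rewrite /c mulrAC ler_pdivrMr ?ltr_wpDl// ler_pM2l ?divr_gt0//.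
  by rewrite lerDl.
exists c; first by rewrite !divr_gt0// ltr_wpDl.
exists l => K; apply: contrapT => noK.
pose C m := bfun_maxn h m (l m).
pose D m := bfun_max (C m) (h K) - C m.
have D_ge0 m x : 0 <= D m x by rewrite bfunD bfunN subr_ge0 /= le_max lexx.
(* D m is the positive part of h K - C m; max (C m) (h K) is bounded by the
   maximum over a longer block from m, one reaching index K. *)
have TD m : (m <= K)%N -> T (D m) <= eps m.
  move=> mK; rewrite linearB/= lerBlDl.
  apply: le_trans (lP m (maxn (l m) (K - m))).
  apply: positive_functional_le => x /=; rewrite ge_max; apply/andP; split.
    have [j /andP[mj jl] ->] := bfun_maxn_attained h m (l m) x.
    by apply: bfun_maxn_ge; rewrite mj (leq_trans jl)// leq_add2l leq_maxl.
  by apply: bfun_maxn_ge; rewrite mK -leq_subLR leq_maxr.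
(* At each x some C m x is below c, so a single D m accounts for h K x - c. *)
have hK : T (h K) <= T (bfun_cst c + \sum_(m < K.+1) D m).
  apply: positive_functional_le => x; rewrite bfunD bfun_sum /=.
  have [m mK hc] : exists2 m, (m < K.+1)%N & C m x < c.
    apply: contrapT => nom; apply: noK; exists x => m mK.
    have [j jm Cj] := bfun_maxn_attained h m (l m) x; exists j => //.
    by rewrite -Cj leNgt; apply/negP => Cc; apply: nom; exists m.
  rewrite (bigD1 (Ordinal mK))//= addrA.
  apply: ler_wpDr; first by apply: sumr_ge0 => i _; exact: D_ge0.
  have : h K x <= Num.max (C m x) (h K x) by rewrite le_max lexx orbT.
  by rewrite -[X in _ <= c + X]/(Num.max (C m x) (h K x) - C m x); move: hc; lra.
have : T (h K) <= eta / 4 + eta / 2.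
  apply: (le_trans hK); rewrite linearD linear_sum positive_functional_cst.
  apply: lerD => //; apply: le_trans (sum_dyadic_le (eta := eta / 2) K.+1 _).
    by apply: ler_sum => m _; apply: TD; rewrite -ltnS.
  by rewrite divr_ge0// ltW.
by have := hT K; move: eta0; lra.
Qed.

End PositiveFunctionals.

(** * Exchanging positive functionals and sequences of points *)

(** The values T (g n) are traded for pointwise limits phi n along a sequence in
    X. There is no term-by-term comparison between phi n and T (g n): only
    lower bounds on infinitely many Cesaro averages survive. *)
Lemma cesaro_representing_points (R : realType) (X : Type) (T : {scalar bfun X R})
    (T_ge0 : positive_functional T) (g : nat -> bfun X R) (M d : R) :
  (forall n x, 0 <= g n x <= M) -> 0 < d ->
  (forall m, exists2 N, (m <= N)%N & d <= cesaro (fun n => T (g n)) N) ->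
  exists (s : nat -> X) (phi : nat -> R) (c : R),
    [/\ 0 < c, forall n, (fun k => g n (s k) : R) @ \oo --> phi n &
        forall m, exists2 N, (m <= N)%N & c <= cesaro phi N].
Proof.
move=> gM d0 Tg.
have /choice[Ns NsP] j : exists N, (j <= N)%N /\ d <= cesaro (fun n => T (g n)) N.
  by have [N] := Tg j; exists N.
pose h j : bfun X R := (Ns j)%:R^-1 *: \sum_(1 <= n < (Ns j).+1) g n.
have hE j x : h j x = cesaro (fun n => g n x) (Ns j).
  by rewrite /h bfunZ bfun_sum mulrC.
have ThE j : T (h j) = cesaro (fun n => T (g n)) (Ns j).
  by rewrite /h linearZ/= linear_sum/= mulrC.
have hM j x : h j x <= M.
  have M0 : 0 <= M by have /andP[g0 gle] := gM 0%N x; exact: le_trans g0 gle.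
  by rewrite hE; case/andP: (cesaro_bounded M0 (fun n => gM n x) (Ns j)).
have hT j : d <= T (h j) by rewrite ThE; case: (NsP j).
have [c c0 [l /choice[y yP]]] := positive_functional_fatou T_ge0 d0 hM hT.
have [U [propU ooU cvgU]] := free_ultralimit R.
pose phi n := lim (g n (y k) @[k --> U]) : R.
have gphi n : g n (y k) @[k --> U] --> phi n.
  apply: (cvgU (fun k => g n (y k)) M) => k.
  by case/andP: (gM n (y k)) => g0 g1; rewrite ger0_norm.
have [s sP] := diagonal_subsequence (g := fun n k => g n (y k)) propU gphi.
exists (y \o s), phi, c; split => // m.
(* If every average in the block of m had limit below c, all of them would be
   below c at y_k for a common k >= m, contradicting the choice of y_k. *)
suff [j [mj cj]] : exists j, (m <= j)%N /\ c <= cesaro phi (Ns j).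
  have [jN _] := NsP j; by exists (Ns j); rewrite // (leq_trans mj jN).
apply: contrapT => noj.
have small : \forall k \near U, forall i : 'I_(l m).+1,
    cesaro (fun n => g n (y k)) (Ns (m + i)%N) < c.
  apply: filter_forall => i.
  apply: cvgr_lt (cvg_cesaro (N := Ns (m + i)%N) _ gphi) _ _.
  by rewrite ltNge; apply/negP => ci; apply: noj; exists (m + i)%N; rewrite leq_addr.
have large : \forall k \near U, (m <= k)%N by apply: ooU; exact: nbhs_infty_ge.
have [k [smallk mk]] := filter_ex (filterI small large).
have [j /andP[mj jl]] := yP k m mk; rewrite hE => cj.
have jm : (j - m < (l m).+1)%N by rewrite ltnS leq_subLR.
by have := smallk (Ordinal jm); rewrite /= subnKC// ltNge cj.
Qed.

(** The functional is the limit along a free ultrafilter of the values at x k.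
    Such limits commute with absolute values, which gives the lower bound. *)
Lemma positive_functional_of_points (R : realType) (X : Type) (x : nat -> X) :
  exists T : {scalar bfun X R}, positive_functional T /\
    forall (g : bfun X R) (r : R), (\forall k \near \oo, r <= `|g (x k)|) -> r <= `|T g|.
Proof.
have [U [propU ooU cvgU]] := free_ultralimit R.
pose t (g : bfun X R) : R := lim (g (x k) @[k --> U]).
have tP (g : bfun X R) : g (x k) @[k --> U] --> t g.
  have [M gM] := bfun_bounded g.
  exact: (cvgU (fun k => g (x k)) M).
have t_linear : linear_for *%R t.
  move=> a g h.
  have aghP : a * g (x k) + h (x k) @[k --> U] --> a * t g + t h.
    by apply: cvgD (tP h); exact: cvgMl_tmp (tP g).
  exact: cvg_lim aghP.
pose T : {scalar bfun X R} := HB.pack t (GRing.isLinear.Build _ _ _ _ t t_linear).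
exists T; split.
  by move=> g g0; apply: limr_ge; [exact: tP|exact: filterE].
move=> g r rg.
have tgn : `|g (x k)| @[k --> U] --> `|t g| by exact: cvg_norm (tP g).
rewrite -[T g]/(t g) -(cvg_lim _ tgn)//; apply: limr_ge.
  by apply/cvg_ex; exists `|t g|.
exact: ooU.
Qed.

Theorem theorem1p2 (R : realType) (X : Type) (f : nat -> bfun X R)
    (f_bounded : uniformly_bounded f) :
  (exists (T : {scalar bfun X R}) (I : set nat) (r : R),
     [/\ positive_functional T, infinite_set I, 0 < upper_density R I, 0 < r &
         forall n, I n -> r < `|T (f n)|])
  <->
  (exists (x : nat -> X) (I : set nat) (r : R),
     [/\ 0 < upper_density R I, 0 < r &
         forall n, I n -> r < limn_inf (fun k => `|f n (x k)|)]).
Proof.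
have [M M0 fM] := f_bounded; split.
  move=> [T [I [r [T_ge0 _ I0 r0 rT]]]].
  have [d d0 Id] := upper_density_gt0 I0.
  pose g n := bfun_norm (f n).
  have gM n x : 0 <= g n x <= M by rewrite normr_ge0 fM.
  have Tg m : exists2 N, (m <= N)%N & r * d <= cesaro (fun n => T (g n)) N.
    have [N mN dN] := Id m; exists N => //.
    apply: (@le_trans _ _ (r * cesaro (fun k => (k \in I)%:R) N)).
      by rewrite ler_pM2l// ltW.
    rewrite -cesaroZ; apply: ler_cesaro => k.
    have Tfk : `|T (f k)| <= T (g k) := positive_functional_norm T_ge0 (f k).
    apply: le_trans Tfk; have [/set_mem Ik|_] := boolP (k \in I).
      by rewrite mulr1 ltW// rT.
    by rewrite mulr0.
  have [s [phi [c [c0 gphi cphi]]]] :=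
    cesaro_representing_points T_ge0 gM (mulr_gt0 r0 d0) Tg.
  exists s, [set n | c / 2 < phi n], (c / 2); split.
  - apply: (upper_density_superlevel (b := M) c0 _ cphi) => n.
    rewrite -(cvg_lim _ (gphi n))//; apply/andP; split.
      apply: limr_ge; first by apply/cvg_ex; exists (phi n).
      by apply: filterE => k; case/andP: (gM n (s k)).
    apply: limr_le; first by apply/cvg_ex; exists (phi n).
    by apply: filterE => k; case/andP: (gM n (s k)).
  - exact: divr_gt0.
  - move=> n /= cn; have [-> _] := cvg_limn_inf_sup (gphi n); exact: cn.
move=> [x [I [r [I0 r0 rI]]]].
have [T [T_ge0 rT]] := positive_functional_of_points R x.
exists T, I, (r / 2); split => //.
  exact: (upper_density_gt0_infinite I0).
  exact: divr_gt0.
move=> n In; apply: (@lt_le_trans _ _ r).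
  by rewrite gtr_pMr// invf_lt1// ltr1n.
apply: rT; have bf : bounded_fun ((fun k => `|f n (x k)|) : nat -> R^o).
  exists M; split; first exact: num_real.
  by move=> N MN k _ /=; rewrite normr_id (le_trans (fM _ _))// ltW.
by apply: filterS (near_gt_limn_inf bf (rI n In)) => k /ltW.
Qed.
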